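(* Let $G=(V,E)$ be a graph with $|V|=n$, and let $2\leq k\leq \lfloor n/2\rfloor$. Then \[ \lambda_{\max}^{(k)}(G) \leq \frac{k}{k-1}\, \lambda_{\max}^{(k-1)}(G) \qquad\text{and}\qquad \lambda_{\min}^{(k)}(G)\geq \frac{k}{k-1}\,\lambda_{\min}^{(k-1)}(G) - k . \]
   Context: For a graph $G=(V,E)$ and $0\le k\le |V|$, the $k$-th token graph $F_k(G)$ is the graph whose vertices are the $k$-element subsets of $V$, with $\{A,B\}$ an edge iff $|A\cap B|=k-1$ and the symmetric difference $A\triangle B$ is an edge of $G$. $L(H)$ denotes the Laplacian matrix of a graph $H$ (diagonal entries the degrees, off-diagonal entry $-1$ for adjacent vertices and $0$ otherwise), and $L_k(G)=L(F_k(G))$. For $1\le k\le\lfloor n/2\rfloor$, an eigenvalue $\lambda$ of $L_k(G)$ is called non-trivial if its multiplicity as an eigenvalue of $L_k(G)$ is larger than its multiplicity as an eigenvalue of $L_{k-1}(G)$ (multiplicity $0$ if it is not an eigenvalue). $\lambda_{\max}^{(k)}(G)$ denotes the largest eigenvalue of $L_k(G)$, and $\lambda_{\min}^{(k)}(G)$ denotes the smallest non-trivial eigenvalue of $L_k(G)$. *)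

(* Defs.v *)
From mathcomp Require Import all_boot all_order all_algebra.
From mathcomp Require Import polyrcf.

Set Implicit Arguments.
Unset Strict Implicit.
Unset Printing Implicit Defensive.

Import Order.TTheory GRing.Theory Num.Theory.
Local Open Scope ring_scope.

Record sgraph := SGraph {
  vertex :> finType;
  edge : rel vertex;
  edge_sym : symmetric edge;
  edge_irrefl : irreflexive edge }.

Section Token.
Variables (G : sgraph) (k : nat).

Definition token := {A : {set G} | #|A| == k}.

(* The condition |A :&: B| = k - 1 is written without truncated subtraction,
   so that F_0(G) is the graph with the single vertex set0 and no edge. *)
Definition token_edge (A B : token) : bool :=
  (#|val A :&: val B|.+1 == k)
  && [exists x : G, [exists y : G, edge x y
       && ((val A :\: val B) :|: (val B :\: val A) == [set x; y])]].

Lemma token_edge_sym : symmetric token_edge.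
Proof. by move=> A B; rewrite /token_edge setIC setUC. Qed.

Lemma token_edge_irrefl : irreflexive token_edge.
Proof.
move=> A; apply/negP => /andP[/eqP cAA _]; move/eqP: (valP A).
by rewrite -[in RHS]cAA setIid => /eqP; rewrite ltn_eqF.
Qed.

Definition token_graph : sgraph := SGraph token_edge_sym token_edge_irrefl.

End Token.

Definition laplacian (R : pzRingType) (H : sgraph) : 'M[R]_#|H| :=
  \matrix_(i, j)
    if i == j then #|[set v : H | edge (enum_val i) v]|%:R
    else if edge (enum_val i) (enum_val j) then -1 else 0.

Definition token_laplacian (R : pzRingType) (G : sgraph) (k : nat) :=
  laplacian R (token_graph G k).

Section Spectrum.
Variable R : rcfType.

(* The distinct eigenvalues of A lying in R, in increasing order. *)
Definition spectrum n (A : 'M[R]_n) : seq R := rootsR (char_poly A).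

Lemma mem_spectrum n (A : 'M[R]_n) a : (a \in spectrum A) = eigenvalue A a.
Proof.
rewrite eigenvalue_root_char /spectrum.
by rewrite -roots_on_rootsR ?monic_neq0 ?char_poly_monic.
Qed.

Lemma spectrum_sorted n (A : 'M[R]_n) : sorted <%R (spectrum A).
Proof. exact: sorted_roots. Qed.

Definition multiplicity n (A : 'M[R]_n) (a : R) : nat := \rank (eigenspace A a).

Definition nontrivial_eigenvalue (G : sgraph) (k : nat) (a : R) : bool :=
  eigenvalue (token_laplacian R G k) a
  && (multiplicity (token_laplacian R G k.-1) a
      < multiplicity (token_laplacian R G k) a)%N.

(* The default value 0 is never reached (k <= #|G| for lambda_max,
   1 <= k <= #|G| %/ 2 for lambda_min): a symmetric matrix over a real closed
   field is diagonalizable, so the multiplicities for L_k(G) sum to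
   'C(#|G|, k), which is positive, resp. larger than 'C(#|G|, k.-1). *)
Definition lambda_max (G : sgraph) (k : nat) : R :=
  last 0 (spectrum (token_laplacian R G k)).

Definition lambda_min (G : sgraph) (k : nat) : R :=
  head 0 [seq a <- spectrum (token_laplacian R G k)
             | nontrivial_eigenvalue G k a].

Lemma sorted_le_last (s : seq R) a :
  sorted <%R s -> a \in s -> last 0 s \in s /\ a <= last 0 s.
Proof.
case/lastP: s => // s x s_lt sa; rewrite last_rcons.
split; first by rewrite mem_rcons mem_head.
move: sa; rewrite mem_rcons inE => /orP[/eqP-> // | sa].
have: pairwise <%R (rcons s x) by rewrite -sorted_pairwise //; apply: lt_trans.
by rewrite pairwise_rcons => /andP[/allP/(_ a sa)/ltW].
Qed.

Lemma sorted_head_le (s : seq R) a :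
  sorted <%R s -> a \in s -> head 0 s \in s /\ head 0 s <= a.
Proof.
case: s => // x s s_lt sa; split; first exact: mem_head.
move: s_lt sa; rewrite sorted_pairwise; last exact: lt_trans.
rewrite /= inE => /andP[/allP x_lt _].
by case/orP=> [/eqP-> // | /x_lt/ltW].
Qed.

Lemma lambda_maxP (G : sgraph) k a : eigenvalue (token_laplacian R G k) a ->
  eigenvalue (token_laplacian R G k) (lambda_max G k) /\ a <= lambda_max G k.
Proof.
by rewrite -!mem_spectrum => /(sorted_le_last (spectrum_sorted _)).
Qed.

Lemma lambda_minP (G : sgraph) k a : nontrivial_eigenvalue G k a ->
  nontrivial_eigenvalue G k (lambda_min G k) /\ lambda_min G k <= a.
Proof.
move=> ka; have sa : a \in [seq b <- spectrum (token_laplacian R G k)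
                               | nontrivial_eigenvalue G k b].
  by rewrite mem_filter ka mem_spectrum; case/andP: ka.
have [|+ le_a] := sorted_head_le _ sa.
  by rewrite sorted_filter ?spectrum_sorted //; apply: lt_trans.
by rewrite mem_filter => /andP[-> _].
Qed.

End Spectrum.

(* Main.v *)
Require Import Defs.
From mathcomp Require Import all_boot all_order all_algebra.
From mathcomp Require Import perm sesquilinear mxred spectral complex.
From mathcomp Require Import ring lra zify.
Set Implicit Arguments.
Unset Strict Implicit.
Unset Printing Implicit Defensive.
Import Order.TTheory GRing.Theory Num.Theory.
Local Open Scope ring_scope.

(** View vectors indexed by k-sets as functions f on the sets of vertices, and
    let f_w be the link of f at a vertex w, i.e. f_w(B) = f(B + w) if w is not
    in B and 0 otherwise. Writing L for the Laplacian of every token graph,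
      sum_w <f_w, L f_w> = (k - 1) <f, L f> + 2 sum_A e(A) f(A)^2,
      sum_w |f_w|^2 = k |f|^2,
    where e(A) is the number of edges inside A, so 0 <= 2 e(A) <= k (k - 1).
    The first claim is Rayleigh's principle for the f_w. For the second one,
    L commutes with the operator D f(B) = sum_(w notin B) f(B + w), whose
    transpose is injective below the middle level, as D D^T - D^T D = n - 2k.
    Hence the non-trivial eigenvalues are those having an eigenfunction in
    ker D, and D f = 0 implies D f_w = 0. *)

(** * Rayleigh's principle over a real closed field *)

Section Rayleigh.
Variable R : rcfType.

(** Over [R[i]] the matrix is Hermitian, so the spectral theorem makes it similar to a real diagonal
    matrix; two real matrices similar over [R[i]] are already similar over [R]. *)
Lemma symmetric_diagonalizable n (M : 'M[R]_n) :
  M^T = M -> exists2 P, P \in unitmx & exists d, P *m M = diag_mx d *m P.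
Proof.
move=> Msym; pose toC : {rmorphism R -> R[i]%C} := real_complex R.
have toC_real m p (B : 'M[R]_(m, p)) : map_mx toC B \is a realmx.
  by apply/mxOverP => i j; rewrite mxE; apply/complex_realP; exists (B i j).
have Mherm : map_mx toC M \is hermsymmx.
  apply: realsym_hermsym; last exact: toC_real.
  apply/is_hermitianmxP; rewrite expr0 scale1r map_mx_id //.
  by apply/matrixP => i j; rewrite !mxE -{1}Msym mxE.
have reP m p (B : 'M_(m, p)) : B \is a realmx -> {B' | B = map_mx toC B'}.
  move=> /mxOverP Breal; exists (map_mx (@complex.Re R) B).
  apply/matrixP => i j; rewrite !mxE.
  by have /complex_realP[x ->] := Breal i j.
have [d dE] := reP _ _ _ (hermitian_spectral_diag_real Mherm).
have [|||P] := @real_similar _ _ (map_mx toC M) (map_mx toC (diag_mx d)).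
- exists (spectralmx (map_mx toC M)); first exact: spectral_unit.
  apply/similarP; first exact: spectral_unit.
  rewrite {2}(orthomx_spectralP (hermitian_normalmx Mherm)) !mulmxA.
  by rewrite mulmxV ?spectral_unit // mul1mx dE map_diag_mx.
- exact: toC_real.
- exact: toC_real.
rewrite inE => /andP[/reP[Q ->] Qunit] /(similarP Qunit).
rewrite map_unitmx in Qunit => QM; exists Q => //; exists d.
by apply: (map_mx_inj (f := toC)); rewrite !map_mxM.
Qed.

(* [D] maps the [a]-eigenspace of [M] into that of [N], and eigenspaces are in
   direct sum, so each eigencomponent of a vector of [ker D] is in [ker D]. *)
Lemma eigen_decomposition n m (M : 'M[R]_n) (N : 'M_m) (D : 'M_(n, m))
    (v : 'rV_n) : M^T = M -> M *m D = D *m N -> v *m D = 0 ->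
  exists p, exists a : 'I_p -> R, exists2 w : 'I_p -> 'rV_n,
    v = \sum_i w i &
    [/\ injective a, forall i, w i *m M = a i *: w i & forall i, w i *m D = 0].
Proof.
move=> /symmetric_diagonalizable[P Punit [d PM]] MD vD.
have dia : diagonalizable M.
  by exists P => //; apply/similar_diagPex; exists d; apply/similarP.
have /diagonalizablePeigen[rs rs_uniq rsP] := dia.
rewrite (big_nth 0) big_mkord in rsP.
have rsI : injective (fun i : 'I_(size rs) => rs`_i).
  by move=> i j /eqP; rewrite nth_uniq // => /eqP/val_inj.
have /sub_sumsmxP[u vE] : (v <= \sum_(i < size rs) eigenspace M rs`_i)%MS.
  by rewrite rsP submx1.
exists (size rs), (fun i => rs`_i); exists (fun i => u i *m eigenspace M rs`_i) => //.
have wM i : u i *m eigenspace M rs`_i *m M = rs`_i *: (u i *m eigenspace M rs`_i).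
  by apply/eigenspaceP; rewrite submxMl.
split=> //= i; apply/eqP; move: i.
have wN i : (u i *m eigenspace M rs`_i *m D <= eigenspace N rs`_i)%MS.
  by apply/eigenspaceP; rewrite -mulmxA -MD mulmxA wM -scalemxAl.
have /mxdirect_sumsP dir : mxdirect (\sum_(i < size rs) eigenspace N rs`_i).
  by apply: mxdirect_sum_eigenspace => i j _ _ /rsI.
move=> i; rewrite -submx0 -(dir i) // sub_capmx wN /=.
have -> : u i *m eigenspace M rs`_i *m D =
    - \sum_(j | j != i) u j *m eigenspace M rs`_j *m D.
  apply/eqP; rewrite -addr_eq0 -(bigD1 i (P := predT)) //=.
  by rewrite -mulmx_suml -vE vD.
by rewrite eqmx_opp; apply: summx_sub_sums => j _; apply: wN.
Qed.

Lemma dotmx_eigen_orthogonal n (M : 'M[R]_n) a b (u v : 'rV_n) :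
  M^T = M -> u *m M = a *: u -> v *m M = b *: v -> a != b -> u *m v^T = 0.
Proof.
move=> Msym uM vM ab; apply/eqP.
have: a *: (u *m v^T) == b *: (u *m v^T).
  by rewrite scalemxAl -uM -mulmxA -{1}Msym -trmx_mul vM linearZ /= -scalemxAr.
by rewrite -subr_eq0 -scalerBl scaler_eq0 subr_eq0 (negPf ab).
Qed.

(** Both quadratic forms split over the eigencomponents of [v], which lie in the kernel of [D], so
    only eigenvalues with an eigenvector there matter. *)
Lemma rayleigh_ge n m (M : 'M[R]_n) (N : 'M_m) (D : 'M_(n, m)) c :
    M^T = M -> M *m D = D *m N ->
    (forall a (w : 'rV_n), w != 0 -> w *m M = a *: w -> w *m D = 0 -> c <= a) ->
  forall v : 'rV_n, v *m D = 0 -> c * (v *m v^T) 0 0 <= (v *m M *m v^T) 0 0.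
Proof.
move=> Msym MD c_min v vD.
have [p [a [w vE [a_inj wM wD]]]] := eigen_decomposition Msym MD vD.
(* Cross terms vanish: the components belong to distinct eigenvalues of a symmetric matrix. *)
have wv i : w i *m v^T = w i *m (w i)^T.
  rewrite vE linear_sum /= mulmx_sumr (bigD1 i) //= big1 ?addr0 // => j ji.
  apply: dotmx_eigen_orthogonal Msym (wM i) (wM j) _.
  by rewrite (inj_eq a_inj) eq_sym.
rewrite {1 3}vE !mulmx_suml !summxE mulr_sumr; apply: ler_sum => i _.
rewrite wM -scalemxAl [leRHS]mxE wv.
have [->|w0] := eqVneq (w i) 0; first by rewrite mul0mx mxE !mulr0.
apply: ler_wpM2r; last exact: c_min (w0) (wM i) (wD i).
by rewrite mxE sumr_ge0 // => j _; rewrite mxE -expr2 sqr_ge0.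
Qed.

Lemma exists_eigenvector n m (M : 'M[R]_n) (N : 'M_m) (D : 'M_(n, m)) (v : 'rV_n) :
    M^T = M -> M *m D = D *m N -> v != 0 -> v *m D = 0 ->
  exists a, exists2 w : 'rV_n, w != 0 & w *m M = a *: w /\ w *m D = 0.
Proof.
move=> Msym MD v0 vD.
have [p [a [w vE [_ wM wD]]]] := eigen_decomposition Msym MD vD.
have [i wi] : exists i, w i != 0.
  apply/existsP; apply: contraR v0 => /existsPn w0.
  by rewrite vE big1 // => i _; apply/eqP/negPn/w0.
by exists (a i); exists (w i).
Qed.

End Rayleigh.

(** * Functions on sets of vertices *)

Section SetFunctions.
Variables (R : rcfType) (G : sgraph).
Implicit Types (f g : {set G} -> R) (A B : {set G}) (x y w : G).

(** Acting by a transposition gives a total, cardinality-preserving operation; it moves a token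
    along [xy] exactly when [A] contains one of the two endpoints. *)
Definition swap x y A : {set G} := [set z | tperm x y z \in A].
Definition dot f g : R := \sum_A f A * g A.
Definition up f A : R := \sum_(w in A) f (A :\ w).
Definition down f A : R := \sum_(w | w \notin A) f (w |: A).
Definition link w f A : R := if w \in A then 0 else f (w |: A).
(* Twice the Laplacian of the token graphs: [p] runs over both orientations of
   each edge, and [swap] fixes [A] unless the edge leaves [A]. *)
Definition lap2 f A : R :=
  \sum_(p : G * G | edge p.1 p.2) (f A - f (swap p.1 p.2 A)).
Definition adjacencies A := [set p : G * G | [&& edge p.1 p.2, p.1 \in A & p.2 \in A]].

Lemma edge_neq x y : edge x y -> x != y.
Proof. by apply: contraTneq => ->; rewrite edge_irrefl. Qed.

Lemma swap_id x y A : (x \in A) = (y \in A) -> swap x y A = A.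
Proof. by move=> xy; apply/setP => z; rewrite inE; case: tpermP => [->|->|]. Qed.

Lemma swapC x y A : swap x y A = swap y x A.
Proof. by rewrite /swap tpermC. Qed.

Lemma swapU1 x y w A : swap x y (w |: A) = tperm x y w |: swap x y A.
Proof.
by apply/setP => z; rewrite !inE -(inj_eq (@perm_inj _ (tperm x y)) z) tpermK.
Qed.

Lemma swapD1 x y w A : swap x y (A :\ w) = swap x y A :\ tperm x y w.
Proof.
by apply/setP => z; rewrite !inE -(inj_eq (@perm_inj _ (tperm x y)) z) tpermK.
Qed.

Lemma card_swap x y A : #|swap x y A| = #|A|.
Proof.
rewrite -(card_imset A (@perm_inj _ (tperm x y))); congr #|pred_of_set _|.
apply/setP => z; rewrite inE -[in RHS](tpermK x y z) mem_imset //.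
exact: perm_inj.
Qed.

(** * Adjointness and commutation of the level operators *)

Lemma sum_setU1 w (F : {set G} -> R) :
  \sum_(B : {set G} | w \notin B) F (w |: B) = \sum_(A : {set G} | w \in A) F A.
Proof.
rewrite [RHS](reindex_onto (fun B => w |: B) (fun A => A :\ w)) => [|A wA].
  apply: eq_bigl => B; rewrite setU11 /=; apply/idP/eqP => [/setU1K //|<-].
  by rewrite !inE eqxx.
exact: setD1K.
Qed.

(** Both sides sum [f B * g (w |: B)] over all pairs with [w] outside [B]. *)
Lemma dot_up f g : dot (up f) g = dot f (down g).
Proof.
transitivity (\sum_w \sum_(A : {set G} | w \in A) f (A :\ w) * g A).
  rewrite (exchange_big_dep predT) //=; apply: eq_bigr => A _.
  by rewrite /up mulr_suml.
transitivity (\sum_w \sum_(B : {set G} | w \notin B) f B * g (w |: B)).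
  apply: eq_bigr => w _; rewrite -sum_setU1; apply: eq_bigr => B wB.
  by rewrite setU1K.
rewrite (exchange_big_dep predT) //=; apply: eq_bigr => A _.
by rewrite /down mulr_sumr.
Qed.

(** Both composites add some [w] and remove some [z]. The terms with [w = z] give multiples of
    [f A]; the remaining terms coincide. *)
Lemma down_up f A :
  down (up f) A + #|A|%:R * f A = up (down f) A + #|~: A|%:R * f A.
Proof.
have -> : down (up f) A = #|~: A|%:R * f A
    + \sum_(w | w \notin A) \sum_(z in A) f ((w |: A) :\ z).
  rewrite mulr_natl -sumr_const.
  rewrite [X in _ = X + _](eq_bigl (fun w => w \notin A)) => [|w]; last by rewrite inE.
  rewrite -big_split /=.
  apply: eq_bigr => w wA; rewrite /up big_setU1 //= setU1K //.
have -> : up (down f) A = #|A|%:R * f A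
    + \sum_(z in A) \sum_(w | w \notin A) f ((w |: A) :\ z).
  rewrite mulr_natl -sumr_const -big_split /=.
  apply: eq_bigr => z zA; rewrite /down (bigD1 z) /=; last by rewrite !inE eqxx.
  rewrite setD1K //; congr (_ + _); apply: eq_big => [w|w].
    rewrite !inE; case: eqVneq => [->|]; rewrite ?zA ?andbF ?andbT //.
  rewrite !inE => /andP[wA wz]; congr f; apply/setP => t; rewrite !inE.
  by case: (eqVneq t w) => [->|]; rewrite ?wz.
rewrite [\sum_(z in A) _]exchange_big /=; ring.
Qed.

(** [down] commutes with every permutation of the vertices, in particular with each [swap]. *)
Lemma down_lap2 f A : down (lap2 f) A = lap2 (down f) A.
Proof.
rewrite /down /lap2 exchange_big /=; apply: eq_bigr => -[x y] /= xy.
rewrite sumrB; congr (_ - _).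
rewrite [RHS](reindex_inj (@perm_inj _ (tperm x y))) /=.
apply: eq_big => [w|w wA]; last by rewrite swapU1.
by rewrite inE tpermK.
Qed.

(** Additions of two vertices commute, and the term that would add [w] twice is killed by [link]. *)
Lemma down_link w f A : down (link w f) A = link w (down f) A.
Proof.
rewrite /down /link; case: ifPn => wA.
  by rewrite big1 // => z _; rewrite !inE wA orbT.
rewrite (bigD1 w) //= !inE eqxx add0r; apply: eq_big => [z|z /andP[zA zw]].
  by rewrite !inE negb_or andbC.
by rewrite !inE eq_sym (negPf zw) (negPf wA) setUCA.
Qed.

(** * Quadratic forms summed over all links *)

Lemma dot_link w f g :
  dot (link w f) g = \sum_(A : {set G} | w \in A) f A * g (A :\ w).
Proof.
rewrite -sum_setU1 /dot [LHS](bigID (fun B : {set G} => w \in B)) /= big1 ?add0r.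
  by apply: eq_bigr => B wB; rewrite /link (negPf wB) setU1K.
by move=> B wB; rewrite /link wB mul0r.
Qed.

Lemma link_swap x y w f A : w != x -> w != y -> w \in A ->
  link w f (swap x y (A :\ w)) = f (swap x y A).
Proof.
move=> wx wy wA; rewrite swapD1 tpermD 1?eq_sym // /link !inE eqxx /=.
by rewrite setD1K // inE tpermD 1?eq_sym.
Qed.

(** If [A] contains exactly one endpoint, removing it gives a set fixed by [swap], hence a zero
    term, and the other [k] terms are equal. If it contains both, only [w = x] and [w = y]
    contribute, each [f A]. If it contains none, every term is zero. *)
Lemma sum_link_swap k x y f A : x != y -> #|A| = k.+1 ->
  \sum_(w in A) (f A - link w f (swap x y (A :\ w))) =
  k%:R * (f A - f (swap x y A)) + ((x \in A) && (y \in A))%:R * f A *+ 2.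
Proof.
(* By symmetry in [x] and [y], the case where only [y] is in [A] can be left out. *)
wlog xyA : x y / (y \in A) ==> (x \in A).
  move=> IH xy Ak; have [yA|yA] := boolP (y \in A); last first.
    by have := IH x y; rewrite (negPf yA); apply.
  have [xA|xA] := boolP (x \in A); first by have := IH x y; rewrite xA yA; apply.
  have := IH y x; rewrite (negPf xA) yA eq_sym swapC /= => <- //.
  by apply: eq_bigr => w _; rewrite swapC.
move=> xy Ak; have [xA|xA] := boolP (x \in A); last first.
  rewrite (negPf xA) implybF in xyA; rewrite mul0r mul0rn addr0.
  rewrite swap_id ?(negPf xA) ?(negPf xyA) // subrr mulr0 big1 // => w wA.
  rewrite link_swap ?swap_id ?subrr ?(negPf xA) ?(negPf xyA) //.
    by apply: contraNneq xA => <-.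
  by apply: contraNneq xyA => <-.
rewrite (bigD1 x) //=.
have cAx : #|[predD1 A & x]| = k by move: Ak; rewrite (cardD1 x) xA => -[].
have [yA|yA] := boolP (y \in A).
  rewrite (bigD1 y) /=; last by rewrite yA eq_sym.
  rewrite {1 2}/link !swapD1 tpermL tpermR !inE tpermL tpermR xA yA.
  rewrite (negPf xy) eq_sym (negPf xy) /= !subr0 big1 => [|w].
    by rewrite swap_id ?xA // mul1r subrr mulr0 add0r addr0.
  case/andP=> /andP[wA wx] wy.
  by rewrite link_swap // swap_id ?xA // subrr.
rewrite mul0r mul0rn addr0 swap_id; last by rewrite !inE eqxx (negPf yA) andbF.
rewrite {1}/link !inE eqxx /= setD1K // subrr add0r.
rewrite (eq_bigr (fun=> f A - f (swap x y A))) => [|w /andP[wA wx]]; last first.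
  by rewrite link_swap //; apply: contraNneq yA => <-.
rewrite sumr_const mulr_natl; congr (_ *+ _); rewrite -cAx.
by apply: eq_card => z; rewrite !inE andbC.
Qed.

(** Functions on [k]-sets are kept as functions on all sets, so that [up], [down] and [link] change
    the level without changing the type. *)
Definition supported k f := forall A, #|A| != k -> f A = 0.

Lemma sum_dot_link k f : supported k f ->
  \sum_w dot (link w f) (link w f) = k%:R * dot f f.
Proof.
move=> fk; under eq_bigr do rewrite dot_link.
rewrite (exchange_big_dep predT) //= /dot mulr_sumr; apply: eq_bigr => A _.
have [Ak|/fk->] := eqVneq #|A| k; last by rewrite big1 => [|*]; rewrite !mul0r // mulr0.
rewrite mulr_natl -Ak -sumr_const; apply: eq_bigr => w wA.
by rewrite /link !inE eqxx /= setD1K.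
Qed.

(** After exchanging sums, [sum_link_swap] applies to each set and each oriented edge; the
    correction counts the oriented edges inside the set. *)
Lemma sum_dot_link_lap2 k f : supported k.+1 f ->
  \sum_w dot (link w f) (lap2 (link w f)) =
  k%:R * dot f (lap2 f) + \sum_A #|adjacencies A|%:R * f A ^+ 2 *+ 2.
Proof.
move=> fk; under eq_bigr do rewrite dot_link.
rewrite (exchange_big_dep predT) //= /dot mulr_sumr -big_split /=.
apply: eq_bigr => A _.
have [Ak|/fk->] := eqVneq #|A| k.+1; last first.
  by rewrite big1 => [|*]; rewrite !mul0r ?expr0n /= ?mulr0 ?mul0rn ?addr0.
rewrite /lap2 -mulr_sumr exchange_big /=.
rewrite (eq_bigr (fun p : G * G => k%:R * (f A - f (swap p.1 p.2 A))
    + ((p.1 \in A) && (p.2 \in A))%:R * f A *+ 2)); last first.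
  move=> [x y] /= xy; rewrite -(@sum_link_swap k x y) ?edge_neq //.
  by apply: eq_bigr => w wA; rewrite {1}/link !inE eqxx /= setD1K.
have adjE : \sum_(p : G * G | edge p.1 p.2)
    ((p.1 \in A) && (p.2 \in A))%:R * f A *+ 2 = #|adjacencies A|%:R * f A *+ 2.
  rewrite sumrMnl -mulr_suml -natr_sum; congr (_%:R * _ *+ _).
  rewrite -sum1_card [RHS]big_mkcond [LHS]big_mkcond /=; apply: eq_bigr => p _.
  by rewrite inE; move: (p.1 \in A) (p.2 \in A) => [] []; case: edge.
by rewrite big_split /= adjE -[X in _ * (X + _)]mulr_sumr; ring.
Qed.

(** There are no loops, so adjacencies lie in the square of [A] minus its diagonal. *)
Lemma card_adjacencies k A : #|A| = k.+1 -> (#|adjacencies A| <= k.+1 * k)%N.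
Proof.
move=> Ak; have /subset_leq_card :
    adjacencies A \subset setX A A :\: [set (x, x) | x in A].
  apply/subsetP => -[x y]; rewrite !inE /= => /and3P[/edge_neq xy -> ->].
  rewrite !andbT; apply: contra xy => /imsetP[z _ [-> ->]] //.
rewrite cardsD (setIidPr _) ?cardsX ?card_imset ?Ak => [|x y [] //|].
  by rewrite mulnS mulSn; lia.
by apply/subsetP => _ /imsetP[x xA ->]; rewrite !inE xA.
Qed.

End SetFunctions.

(** * Token Laplacians *)

Lemma laplacian_sym (R : pzRingType) (H : sgraph) :
  (laplacian R H)^T = laplacian R H.
Proof.
apply/matrixP => i j; rewrite !mxE eq_sym.
by case: eqVneq => [->|_] //; rewrite edge_sym.
Qed.

Lemma mul_laplacian (R : comPzRingType) (H : sgraph) (v : 'rV[R]_#|H|) j :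
  (v *m laplacian R H) 0 j =
  \sum_(i | edge (enum_val j) (enum_val i)) (v 0 j - v 0 i).
Proof.
rewrite mxE (bigD1 j) //= mxE eqxx sumrB; congr (_ + _).
  rewrite mulr_natr -sumr_const.
  rewrite -(big_enum_val_cond (edge (enum_val j)) (fun=> v 0 j)) /=.
  by apply: eq_bigl => u; rewrite inE.
rewrite -sumrN [LHS]big_mkcond [RHS]big_mkcond; apply: eq_bigr => i _ /=.
rewrite mxE; case: (eqVneq i j) => [->|ij]; first by rewrite edge_irrefl.
by rewrite edge_sym; case: edge; rewrite ?mulr0 // mulrN1.
Qed.

Section Token.
Variables (R : rcfType) (G : sgraph).
Implicit Types (A B : {set G}) (x y : G).

(** * Token graph edges as moves of one token *)

Lemma token_edgeP k (A B : token G k) :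
  reflect (exists2 p : G * G,
             [&& edge p.1 p.2, p.1 \in val A & p.2 \notin val A] &
             val B = swap p.1 p.2 (val A))
          (token_edge A B).
Proof.
move: (eqP (valP A)) (eqP (valP B)); rewrite /token_edge.
move: (val A) (val B) => {}A {}B cA cB.
apply: (iffP andP) => [[/eqP cAB /existsP[x /existsP[y /andP[xy /eqP AB]]]]|].
  have /cards1P[a aE] : #|A :\: B| == 1%N.
    by rewrite cardsD cA -cAB subSn ?subnn.
  have /cards1P[b bE] : #|B :\: A| == 1%N.
    by rewrite cardsD cB setIC -cAB subSn ?subnn.
  have /andP[aNB aA] : (a \notin B) && (a \in A).
    by rewrite -in_setD aE inE.
  have /andP[bNA bB] : (b \notin A) && (b \in B).
    by rewrite -in_setD bE inE.
  have ab : a != b by apply: contraNneq aNB => ->.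
  exists (a, b) => /=; rewrite ?aA ?bNA ?andbT.
    (* The symmetric difference is both [{a, b}] and [{x, y}], so [(a, b)] is the edge in one of its
       orientations. *)
    move: AB; rewrite aE bE => AB.
    have /set2P ax : a \in [set x; y] by rewrite -AB set21.
    have /set2P bx : b \in [set x; y] by rewrite -AB set22.
    by case: ax bx ab => -> [] ->; rewrite ?eqxx // edge_sym.
  apply/setP => z; rewrite inE; case: tpermP => [->|->|za zb].
  - by rewrite (negPf aNB) (negPf bNA).
  - by rewrite bB aA.
  have [/eqP] := (za, zb); move: (in_set1 z a) (in_set1 z b).
  rewrite -aE -bE !inE; case: (z \in A); case: (z \in B) => //=.
  - by move=> /esym/eqP /za.
  - by move=> _ /esym/eqP /zb.
case=> -[x y] /= /and3P[xy xA yA] BE; split.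
  rewrite -cA (cardsD1 x A) xA BE; apply/eqP; congr _.+1; apply: eq_card => z.
  rewrite !inE; case: tpermP => [->|->|/eqP zx /eqP zy].
  - by rewrite eqxx (negPf yA) andbF.
  - by rewrite (negPf yA) andbF.
  - by rewrite zx andbb.
apply/existsP; exists x; apply/existsP; exists y; rewrite xy BE /=.
apply/eqP/setP => z; rewrite !inE.
have xNy := edge_neq xy.
case: tpermP => [->|->|/eqP zx /eqP zy].
- by rewrite eqxx xA yA.
- by rewrite eqxx xA yA orbT.
- by rewrite (negPf zx) (negPf zy); case: (z \in A).
Qed.

Lemma setD_swap x y A : x \in A -> y \notin A ->
  A :\: swap x y A = [set x] /\ swap x y A :\: A = [set y].
Proof.
move=> xA yA; have xy : x != y by apply: contraNneq yA => <-.
split; apply/setP => z; rewrite !inE; case: tpermP => [->|->|/eqP zx /eqP zy].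
- by rewrite eqxx xA yA.
- by rewrite xA (negPf yA) eq_sym (negPf xy).
- by rewrite (negPf zx) andNb.
- by rewrite xA (negPf xy).
- by rewrite eqxx xA yA.
- by rewrite (negPf zy) andNb.
Qed.

(** Neighbours of [A] correspond to oriented edges leaving [A]; the correspondence is injective
    because the two set differences recover the endpoints. *)
Lemma sum_token_edge k (A : token G k) (h : {set G} -> R) :
  \sum_(B | token_edge A B) h (val B) =
  \sum_(p : G * G | [&& edge p.1 p.2, p.1 \in val A & p.2 \notin val A])
     h (swap p.1 p.2 (val A)).
Proof.
pose N := [set p : G * G | [&& edge p.1 p.2, p.1 \in val A & p.2 \notin val A]].
transitivity (\sum_(B in [set val B | B in [set B | token_edge A B]]) h B).
  rewrite big_imset /=; last by move=> ? ? _ _ /val_inj.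
  by apply: eq_bigl => B; rewrite inE.
rewrite (_ : imset _ _ = [set swap p.1 p.2 (val A) | p in N]).
  rewrite big_imset /=; first by apply: eq_bigl => p; rewrite inE.
  move=> [x y] [x' y']; rewrite !inE /= => /and3P[_ xA yA] /and3P[_ xA' yA'] e.
  have [xE yE] := setD_swap xA yA; have [] := setD_swap xA' yA'.
  by rewrite -e xE yE => /set1_inj -> /set1_inj ->.
apply/setP => B; apply/imsetP/imsetP => [[C]|[p]].
  by rewrite inE => /token_edgeP[p Np CE] BE; exists p; rewrite ?inE ?BE.
rewrite inE => Np BE; have cB : #|B| == k by rewrite BE card_swap (valP A).
by exists (exist _ B cB) => //; rewrite inE; apply/token_edgeP; exists p.
Qed.


(** * Row vectors as functions supported on one level *)

Definition token_set k (i : 'I_#|token_graph G k|) : {set G} :=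
  val (enum_val i : token G k).
Definition setfun k (v : 'rV[R]_#|token_graph G k|) A : R :=
  \sum_i v 0 i * (token_set i == A)%:R.
Definition setrow k (f : {set G} -> R) : 'rV[R]_#|token_graph G k| :=
  \row_i f (token_set i).
Definition down_mx k : 'M[R]_(#|token_graph G k.+1|, #|token_graph G k|) :=
  \matrix_(i, j) down (fun A => (token_set i == A)%:R) (token_set j).

Lemma eq_down (f g : {set G} -> R) : f =1 g -> down f =1 down g.
Proof. by move=> fg A; apply: eq_bigr => w _; rewrite fg. Qed.

Lemma eq_lap2 (f g : {set G} -> R) : f =1 g -> lap2 f =1 lap2 g.
Proof. by move=> fg A; apply: eq_bigr => p _; rewrite !fg. Qed.

Lemma eq_dot (f f' g g' : {set G} -> R) : f =1 f' -> g =1 g' -> dot f g = dot f' g'.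
Proof. by move=> ff' gg'; apply: eq_bigr => A _; rewrite ff' gg'. Qed.

Lemma dot_ge0 (f : {set G} -> R) : 0 <= dot f f.
Proof. by apply: sumr_ge0 => A _; rewrite -expr2 sqr_ge0. Qed.

Lemma dot_eq0 (f : {set G} -> R) : dot f f = 0 -> f =1 fun=> 0.
Proof.
move=> /eqP; rewrite psumr_eq0 => [/allP f0 A|A _]; last by rewrite -expr2 sqr_ge0.
by have := f0 A (mem_index_enum _); rewrite /= mulf_eq0 orbb => /eqP.
Qed.

Lemma card_token_set k (i : 'I_#|token_graph G k|) : #|token_set i| = k.
Proof. exact/eqP/(valP (enum_val i : token G k)). Qed.

Lemma token_set_inj k : injective (@token_set k).
Proof. by move=> i j /val_inj/enum_val_inj. Qed.

Lemma token_set_surj k A : #|A| = k -> exists i, A = @token_set k i.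
Proof.
move=> /eqP Ak; exists (enum_rank (exist _ A Ak : token_graph G k)).
by rewrite /token_set enum_rankK.
Qed.

Lemma card_token k : #|token_graph G k| = 'C(#|G|, k).
Proof.
by rewrite -card_draws /= card_sig; apply: eq_card => A; rewrite !inE.
Qed.

Lemma setfun_token_set k (v : 'rV_#|token_graph G k|) i : setfun v (token_set i) = v 0 i.
Proof.
rewrite /setfun (bigD1 i) //= eqxx mulr1 big1 ?addr0 // => j ji.
by rewrite (inj_eq (@token_set_inj k)) (negPf ji) mulr0.
Qed.

Lemma setfun_supported k (v : 'rV_#|token_graph G k|) : supported k (setfun v).
Proof.
move=> A Ak; apply: big1 => i _; case: eqP => [iA|_]; last by rewrite mulr0.
by rewrite -iA card_token_set eqxx in Ak.
Qed.

Lemma eq_supported k (f g : {set G} -> R) : supported k f -> supported k g ->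
  (forall i : 'I_#|token_graph G k|, f (token_set i) = g (token_set i)) -> f =1 g.
Proof.
move=> fk gk fg A; have [/token_set_surj[i ->] //|Ak] := eqVneq #|A| k.
by rewrite fk ?gk.
Qed.

Lemma setfun_row k (f : {set G} -> R) : supported k f -> setfun (setrow k f) =1 f.
Proof.
move=> fk; apply: (eq_supported (@setfun_supported _ _) fk) => i.
by rewrite setfun_token_set mxE.
Qed.

Lemma setfun_inj k (u v : 'rV_#|token_graph G k|) : setfun u =1 setfun v -> u = v.
Proof. by move=> uv; apply/rowP => i; rewrite -!setfun_token_set uv. Qed.

Lemma setfunZ k a (v : 'rV_#|token_graph G k|) A : setfun (a *: v) A = a * setfun v A.
Proof. by rewrite /setfun mulr_sumr; apply: eq_bigr => i _; rewrite mxE mulrA. Qed.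

Lemma setfun0 k A : setfun (0 : 'rV_#|token_graph G k|) A = 0.
Proof. by rewrite -(scale0r 0) setfunZ mul0r. Qed.

Lemma dot_gt0 k (v : 'rV_#|token_graph G k|) : v != 0 -> 0 < dot (setfun v) (setfun v).
Proof.
move=> v0; rewrite lt_def dot_ge0 andbT; apply: contraNneq v0 => /dot_eq0 f0.
by apply/eqP/setfun_inj => A; rewrite f0 setfun0.
Qed.

Lemma dot_setfun k (u v : 'rV_#|token_graph G k|) :
  (u *m v^T) 0 0 = dot (setfun u) (setfun v).
Proof.
rewrite /dot (bigID (fun A : {set G} => #|A| == k)) /= [X in _ + X]big1 => [|A Ak].
  rewrite addr0 mxE (eq_bigl (fun A => A \in [set token_set i | i : 'I_#|token_graph G k|])).
    rewrite big_imset /=; last by move=> i j _ _ /token_set_inj.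
    by apply: eq_bigr => i _; rewrite mxE !setfun_token_set.
  move=> A; apply/eqP/imsetP => [/token_set_surj[i ->]|[i _ ->]]; last exact: card_token_set.
  by exists i.
by rewrite (setfun_supported u Ak) mul0r.
Qed.

Lemma supported_lap2 k (f : {set G} -> R) : supported k f -> supported k (lap2 f).
Proof. by move=> fk A Ak; apply: big1 => p _; rewrite !fk ?subr0 ?card_swap. Qed.

Lemma supported_down k (f : {set G} -> R) : supported k.+1 f -> supported k (down f).
Proof.
by move=> fk A Ak; apply: big1 => w wA; rewrite fk // cardsU1 wA eqSS.
Qed.

Lemma supported_up k (f : {set G} -> R) : supported k f -> supported k.+1 (up f).
Proof.
move=> fk A Ak; apply: big1 => w wA; rewrite fk //.
by apply: contraNneq Ak => <-; rewrite (cardsD1 w A) wA.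
Qed.

Lemma supported_link k w (f : {set G} -> R) :
  supported k.+1 f -> supported k (link w f).
Proof.
move=> fk A Ak; rewrite /link; case: ifPn => // wA.
by rewrite fk // cardsU1 wA eqSS.
Qed.

(** Each edge leaving the set occurs in [lap2] in both orientations, which gives the factor 2; all
    other edges contribute zero. *)
Lemma lap2_setfun k (v : 'rV_#|token_graph G k|) A :
  lap2 (setfun v) A = 2 * setfun (v *m token_laplacian R G k) A.
Proof.
move: A; apply: (eq_supported (k := k)) => [||i].
- exact/supported_lap2/setfun_supported.
- by move=> A Ak; rewrite setfun_supported ?mulr0.
rewrite setfun_token_set mul_laplacian -setfun_token_set.
rewrite (eq_bigr (fun j => setfun v (token_set i) - setfun v (token_set j))) => [|j _]; last first.
  by rewrite !setfun_token_set.
set A : token_graph G k := enum_val i.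
rewrite -(big_enum_val_cond (edge A)
            (fun C : token_graph G k => setfun v (token_set i) - setfun v (val (C : token G k)))) /=.
rewrite (eq_bigl (fun C => token_edge A C)) //.
rewrite (sum_token_edge A (fun B => setfun v (token_set i) - setfun v B)).
rewrite mulr_natl mulr2n /lap2 -/(val A).
rewrite (bigID (fun p => p.1 \in token_set i)) /=; congr (_ + _).
  rewrite (bigID (fun p => p.2 \in token_set i)) /= big1 ?add0r => [|p].
    by apply: eq_bigl => p; rewrite andbA.
  by case/andP => /andP[_ p1 p2]; rewrite swap_id ?p1 // subrr.
rewrite (bigID (fun p => p.2 \in token_set i)) /= addrC big1 ?add0r => [|p]; last first.
  by case/andP => /andP[_ /negPf p1 /negPf p2]; rewrite swap_id ?p1 // subrr.
(* Reversing the pairs turns entering edges into leaving ones. *)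
rewrite (reindex_inj (h := fun p : G * G => (p.2, p.1))) /=; last by move=> [? ?] [? ?] [-> ->].
apply: eq_big => p; rewrite 1?edge_sym 1?swapC //.
by rewrite -andbA [X in _ && X]andbC.
Qed.

(** * Level-changing matrices and non-trivial eigenvalues *)

Lemma setfun_down k (v : 'rV_#|token_graph G k.+1|) : setfun (v *m down_mx k) =1 down (setfun v).
Proof.
apply: (eq_supported (k := k)) => [||j]; first exact: setfun_supported.
  exact/supported_down/setfun_supported.
rewrite setfun_token_set mxE /down /setfun exchange_big /=; apply: eq_bigr => i _.
by rewrite mxE /down mulr_sumr.
Qed.

Lemma setfun_up k (v : 'rV_#|token_graph G k|) : setfun (v *m (down_mx k)^T) =1 up (setfun v).
Proof.
apply: (eq_supported (k := k.+1)) => [||i]; first exact: setfun_supported.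
  exact/supported_up/setfun_supported.
rewrite setfun_token_set mxE /up /setfun exchange_big /=; apply: eq_bigr => j _.
rewrite !mxE -mulr_sumr /down [in LHS]big_mkcond [in RHS]big_mkcond /=.
congr (_ * _); apply: eq_bigr => w _.
(* For each [w], both terms indicate whether the larger set is the smaller one with [w] added. *)
case: ifP; case: ifP => // wA wB; apply/eqP; rewrite ?(eqr_nat _ _ 0) ?(eqr_nat _ 0) ?eqr_nat.
- apply/eqP; congr (nat_of_bool _); apply/eqP/eqP => [->|->].
    by rewrite setU1K // wB.
  by rewrite setD1K.
- by rewrite eqb0; apply: contraFneq wA => ->; rewrite setU11.
- by rewrite eq_sym eqb0; apply: contraFneq wB => ->; rewrite !inE eqxx.
Qed.

Lemma laplacian_down k :
  token_laplacian R G k.+1 *m down_mx k = down_mx k *m token_laplacian R G k.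
Proof.
apply/row_matrixP => i; rewrite !rowE !mulmxA; set v := delta_mx _ _.
apply: setfun_inj => A; apply: (mulfI (x := 2)); first by rewrite pnatr_eq0.
rewrite -lap2_setfun (eq_lap2 (setfun_down v)) setfun_down -down_lap2 (eq_down (lap2_setfun v)).
by rewrite /down mulr_sumr.
Qed.

(** If [up f = 0], pairing [down_up] with [f] gives [|down f|^2 + (n - 2k) |f|^2 = 0] with
    [n = #|G|], a sum of nonnegative terms, so [f = 0]. *)
Lemma row_free_up k : (k.*2 < #|G|)%N -> row_free (down_mx k)^T.
Proof.
move=> k2; rewrite -kermx_eq0; apply/eqP/row_matrixP => i; rewrite row0.
set u := row i _; have uD : u *m (down_mx k)^T = 0.
  by apply/eqP; rewrite -sub_kermx row_sub.
have up0 : up (setfun u) =1 fun=> 0 by move=> A; rewrite -setfun_up uD setfun0.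
have dduE A : setfun u A * down (up (setfun u)) A =
    setfun u A * up (down (setfun u)) A + (#|G| - k.*2)%:R * (setfun u A * setfun u A).
  have [Ak|Ak] := eqVneq #|A| k; last by rewrite setfun_supported // !mul0r mulr0 addr0.
  have := down_up (setfun u) A; rewrite [#|~: A|]cardsCs setCK Ak.
  rewrite (_ : (#|G| - k = #|G| - k.*2 + k)%N); last by rewrite -addnn in k2 *; lia.
  rewrite natrD => /(canRL (addrK _)) ->; ring.
have : dot (setfun u) (down (up (setfun u))) = 0.
  by rewrite -dot_up /dot big1 // => A _; rewrite up0 mul0r.
rewrite /dot (eq_bigr _ (fun A _ => dduE A)) big_split /= -mulr_sumr.
rewrite -[X in X + _](_ : dot (down (setfun u)) (down (setfun u)) = _); last first.
  by rewrite -dot_up /dot; apply: eq_bigr => A _; rewrite mulrC.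
rewrite -/(dot (setfun u) (setfun u)) => /eqP; rewrite paddr_eq0 ?mulr_ge0 ?ler0n ?dot_ge0 //.
case/andP => _; rewrite mulf_eq0 pnatr_eq0 subn_eq0 leqNgt k2 /= => /eqP /dot_eq0 u0.
by apply: setfun_inj => A; rewrite u0 setfun0.
Qed.

(** [down_mx] maps [E'] into [E], so a larger [E'] meets its kernel. Conversely the transpose embeds
    [E] in [E'] with image orthogonal to that kernel, so [v] adds a dimension. *)
Lemma nontrivial_eigenvalueP k a : (k.*2 < #|G|)%N ->
  reflect (exists2 v : 'rV_#|token_graph G k.+1|, v != 0 &
             v *m token_laplacian R G k.+1 = a *: v /\ v *m down_mx k = 0)
          (nontrivial_eigenvalue G k.+1 a).
Proof.
move=> k2; rewrite /nontrivial_eigenvalue /multiplicity /=.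
set E := eigenspace _ a; set E' := eigenspace (token_laplacian R G k.+1) a.
apply: (iffP andP) => [[_ EE']|[v v0 [vL vD]]].
  have /rowV0Pn[v] : (E' :&: kermx (down_mx k))%MS != 0.
    rewrite -mxrank_eq0 -lt0n -(ltn_add2l (\rank (E' *m down_mx k))) addn0.
    rewrite mxrank_mul_ker; apply: leq_ltn_trans EE'; apply: mxrankS.
    apply/eigenspaceP; rewrite -mulmxA -laplacian_down mulmxA scalemxAl.
    by congr (_ *m _); apply/eigenspaceP.
  by rewrite sub_capmx => /andP[/eigenspaceP vL /sub_kermxP vD] v0; exists v.
split; first by apply/eigenvalueP; exists v.
have <- : \rank (E *m (down_mx k)^T) = \rank E by rewrite mxrankMfree ?row_free_up.
have /mxrankS : (E *m (down_mx k)^T + v <= E')%MS.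
  rewrite addsmx_sub; apply/andP; split; apply/eigenspaceP => //.
  have /(congr1 trmx) := laplacian_down k; rewrite !trmx_mul !laplacian_sym.
  move=> LD; rewrite -mulmxA LD mulmxA scalemxAl; congr (_ *m _).
  exact/eigenspaceP.
(* A multiple [b *: v] in the image of the transpose is orthogonal to [v], hence zero. *)
rewrite mxrank_disjoint_sum => [|]; first by rewrite rank_rV v0 addn1.
apply/eqP/rowV0P => u; rewrite sub_capmx => /andP[/submxP[c ->]].
case/sub_rVP => b cE; rewrite cE.
have : b *: v *m v^T = 0.
  by rewrite -cE -!mulmxA -trmx_mul vD trmx0 !mulmx0.
rewrite -scalemxAl => /eqP; rewrite scaler_eq0 => /orP[/eqP->|/eqP vv].
  by rewrite scale0r.
case/eqP: v0; apply: setfun_inj => A; rewrite setfun0 [LHS]dot_eq0 //.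
by rewrite -dot_setfun vv mxE.
Qed.

(** * Rayleigh bounds and extremal eigenfunctions *)

Lemma dot_lap2_setfun k (v : 'rV_#|token_graph G k|) :
  dot (setfun v) (lap2 (setfun v)) = 2 * (v *m token_laplacian R G k *m v^T) 0 0.
Proof.
rewrite dot_setfun /dot mulr_sumr; apply: eq_bigr => A _.
by rewrite lap2_setfun mulrCA [setfun v A * _]mulrC.
Qed.

Lemma token_rayleigh_max k (f : {set G} -> R) : supported k f ->
  dot f (lap2 f) <= 2 * lambda_max R G k * dot f f.
Proof.
move=> /setfun_row; move: (setrow k f) => v fE.
rewrite -(eq_dot fE fE) -(eq_dot fE (eq_lap2 fE)) dot_lap2_setfun -dot_setfun -mulrA ler_pM2l //.
have sym : (- token_laplacian R G k)^T = - token_laplacian R G k.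
  by rewrite linearN; congr (- _); apply: laplacian_sym.
(* The upper bound is the lower bound for the negated Laplacian; a [D] with no columns makes the
   kernel condition void. *)
have := rayleigh_ge (N := 0) (D := 0 : 'M_(_, 0)) (c := - lambda_max R G k) sym.
rewrite mulmx0 mul0mx => /(_ erefl) H; have {H} := H _ v (mulmx0 _ _).
rewrite mulmxN mulNmx [(- (_ *m v^T)) 0 0]mxE mulNr lerN2; apply=> a w w0 wL _.
have /lambda_maxP[_] : eigenvalue (token_laplacian R G k) (- a).
  by apply/eigenvalueP; exists w; rewrite // scaleNr -wL mulmxN opprK.
by rewrite lerNl.
Qed.

Lemma token_rayleigh_min k (f : {set G} -> R) : (k.*2 < #|G|)%N ->
  supported k.+1 f -> down f =1 (fun=> 0) ->
  2 * lambda_min R G k.+1 * dot f f <= dot f (lap2 f).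
Proof.
move=> k2 /setfun_row; move: (setrow k.+1 f) => v fE df.
rewrite -(eq_dot fE fE) -(eq_dot fE (eq_lap2 fE)) dot_lap2_setfun -dot_setfun -mulrA ler_pM2l //.
apply: (rayleigh_ge (laplacian_sym _ _) (laplacian_down k)) => [a w w0 wL wD|].
  suff /lambda_minP[] : nontrivial_eigenvalue G k.+1 a by [].
  by apply/nontrivial_eigenvalueP => //; exists w.
by apply: setfun_inj => A; rewrite setfun_down (eq_down fE) df setfun0.
Qed.

Lemma lambda_max_eigenfunction k : (k <= #|G|)%N ->
  exists2 f : {set G} -> R, supported k f /\ dot f f > 0 &
    dot f (lap2 f) = 2 * lambda_max R G k * dot f f.
Proof.
move=> kG; set L := token_laplacian R G k.
have c0 : (0 < #|token_graph G k|)%N by rewrite card_token bin_gt0.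
(* Any nonzero vector yields some eigenvalue, so [lambda_max] is not the default value. *)
have v0 : delta_mx 0 (Ordinal c0) != 0 :> 'rV[R]_#|token_graph G k|.
  by apply/eqP => /rowP/(_ (Ordinal c0))/eqP; rewrite !mxE !eqxx oner_eq0.
have LD : L *m (0 : 'M_(_, 0)) = 0 *m (0 : 'M_0) by rewrite !mulmx0.
have [a [w w0 [wL _]]] := exists_eigenvector (laplacian_sym _ _) LD v0 (mulmx0 _ _).
have /lambda_maxP[/eigenvalueP[v vL v_neq0] _] : eigenvalue L a.
  by apply/eigenvalueP; exists w.
exists (setfun v); first by split; [exact: setfun_supported | exact: dot_gt0].
by rewrite dot_lap2_setfun vL -scalemxAl [X in 2 * X]mxE dot_setfun mulrA.
Qed.

Lemma lambda_min_eigenfunction k : (k.*2.+1 < #|G|)%N ->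
  exists2 f : {set G} -> R,
    [/\ supported k.+1 f, dot f f > 0 & down f =1 fun=> 0] &
    dot f (lap2 f) = 2 * lambda_min R G k.+1 * dot f f.
Proof.
move=> k2; have [v0 v0_neq0 v0D] : exists2 v : 'rV_#|token_graph G k.+1|,
    v != 0 & v *m down_mx k = 0.
  have /rowV0Pn[v] : kermx (down_mx k) != 0.
    rewrite -mxrank_eq0 mxrank_ker subn_eq0 -ltnNge.
    apply: leq_ltn_trans (rank_leq_col _) _; rewrite !card_token.
    (* Since [(k+1) C(n,k+1) = (n-k) C(n,k)], the kernel is nonzero once [k + 1 < n - k]. *)
    rewrite -(ltn_pmul2l (ltn0Sn k)) mul_bin_left ltn_pmul2r ?bin_gt0; lia.
  by move=> /sub_kermxP; exists v.
have [a [w w0 [wL wD]]] :=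
  exists_eigenvector (laplacian_sym _ _) (laplacian_down k) v0_neq0 v0D.
have /lambda_minP[] : nontrivial_eigenvalue G k.+1 a.
  by apply/nontrivial_eigenvalueP; [lia | exists w].
case/nontrivial_eigenvalueP => [|v v_neq0 [vL vD] _]; first by lia.
exists (setfun v).
  split; [exact: setfun_supported | exact: dot_gt0 | ].
  by move=> A; rewrite -setfun_down vD setfun0.
by rewrite dot_lap2_setfun vL -scalemxAl [X in 2 * X]mxE dot_setfun mulrA.
Qed.

End Token.

(** * Comparison of extremal eigenvalues on consecutive levels *)

Theorem theorem1p1 (R : rcfType) (G : sgraph) (k : nat)
    (hk2 : (2 <= k)%N) (hkn : (k <= #|G| %/ 2)%N) :
  lambda_max R G k <= k%:R / k.-1%:R * lambda_max R G k.-1 /\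
  lambda_min R G k >= k%:R / k.-1%:R * lambda_min R G k.-1 - k%:R.
Proof.
(* From here the level is [k.+2], so the denominator is [k.+1]. *)
case: k => [|[|k]] // in hk2 hkn *; rewrite /=.
have k1_gt0 : 0 < k.+1%:R :> R by rewrite ltr0n.
split.
  have [|f [fk ff] fL] := @lambda_max_eigenfunction R G k.+2; first by lia.
  have fE := sum_dot_link_lap2 fk.
  have: \sum_w dot (link w f) (lap2 (link w f)) <=
      \sum_w 2 * lambda_max R G k.+1 * dot (link w f) (link w f).
    by apply: ler_sum => w _; apply/token_rayleigh_max/supported_link.
  rewrite -mulr_sumr (sum_dot_link fk) fE fL => H.
  rewrite mulrAC ler_pdivlMr // -(ler_pM2r ff) -(ler_pM2l (ltr0n R 2)) //.
  have e2 : 0 <= \sum_A #|adjacencies A|%:R * f A ^+ 2 *+ 2.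
    by apply: sumr_ge0 => A _; rewrite mulrn_wge0 // mulr_ge0 ?ler0n ?sqr_ge0.
  lra.
have [|f [fk ff df] fL] := @lambda_min_eigenfunction R G k.+1; first by lia.
have fE := sum_dot_link_lap2 fk.
have: \sum_w 2 * lambda_min R G k.+1 * dot (link w f) (link w f) <=
    \sum_w dot (link w f) (lap2 (link w f)).
  (* Each link stays in the kernel of [down], so the bound by [lambda_min] holds one level lower. *)
  apply: ler_sum => w _; apply: token_rayleigh_min; first by lia.
    exact: supported_link.
  by move=> A; rewrite down_link /link df if_same.
rewrite -mulr_sumr (sum_dot_link fk) fE fL => H.
rewrite lerBlDr mulrAC ler_pdivrMr // -(ler_pM2r ff) -(ler_pM2l (ltr0n R 2)) //.
(* Division by [2 * k.+1] turns this bound into the subtracted constant [k.+2]. *)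
have e2 : \sum_A #|adjacencies A|%:R * f A ^+ 2 *+ 2 <=
    2 * (k.+2%:R * k.+1%:R) * dot f f.
  rewrite /dot mulr_sumr; apply: ler_sum => A _.
  have [Ak|/fk->] := eqVneq #|A| k.+2; last by rewrite expr0n !mulr0 mul0rn.
  rewrite -mulr_natl -mulrA ler_pM2l ?ltr0n // -expr2 ler_wpM2r ?sqr_ge0 //.
  by rewrite -natrM ler_nat card_adjacencies.
lra.
Qed.
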